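(* Let $G$ be a tree of order $n$, let $uv\in E(G)$, and let $G'=G\setminus\{uv\}$ be the graph obtained from $G$ by removing the edge $uv$ (keeping all vertices). All degrees below are taken in $G$. Then: (i) if $\deg(u)=\deg(v)=1$, then $meg(G')=0$; (ii) if either ($\deg(u)=1$ and $\deg(v)=2$) or ($\deg(u)\geq 3$ and $\deg(v)\geq 3$), then $meg(G')=meg(G)$; (iii) if $\deg(u)=\deg(v)=2$, then $meg(G')=meg(G)+2$; (iv) if $\deg(u)=2$ and $\deg(v)\geq 3$, then $meg(G')=meg(G)+1$; (v) if $\deg(u)=1$ and $\deg(v)\geq 3$, then $meg(G')=meg(G)-1$.
   Context: Graphs are finite, undirected and simple. In a connected graph $H$, an edge $e$ is monitored by a pair of vertices $x,y$ if $e$ lies on all shortest paths between $x$ and $y$. A set $M\subseteq V(H)$ is a monitoring edge-geodetic set (MEG-set) of $H$ if every edge of $H$ is monitored by some pair of vertices of $M$; $meg(H)$ is the minimum size of a MEG-set of $H$. For a disconnected graph, a MEG-set is the union of MEG-sets of its connected components, where the MEG-set of an isolated vertex is taken to be empty; so $meg$ is the sum of the $meg$ of the components, an isolated vertex contributing $0$. *)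

(* Defs.v *)
From mathcomp Require Import all_boot.
From mathcomp Require Import boolp.

Set Implicit Arguments.
Unset Strict Implicit.
Unset Printing Implicit Defensive.

(* A finite simple graph is a symmetric irreflexive relation on a finType of
   vertices; the edge joining a and b is the pair [set a; b]. *)

Section Graph.
Variables (T : finType) (e : rel T).

Definition simple_graph : Prop := symmetric e /\ irreflexive e.

Definition deg (x : T) : nat := #|[set y | e x y]|.

Definition connected : Prop := forall x y, connect e x y.

Definition acyclic : Prop := forall c : seq T, ucycle e c -> size c <= 2.

Definition tree : Prop := [/\ simple_graph, 0 < #|T|, connected & acyclic].

Definition del_edge (u v : T) : rel T :=
  [rel x y | e x y && ([set x; y] != [set u; v])].

Definition induced (C : {set T}) : rel {x | x \in C} :=
  [rel x y | e (val x) (val y)].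

Definition component (x : T) : {set T} := [set y | connect e x y].

Definition isolated (x : T) : Prop := forall y, ~~ e x y.

(* Walks are given as in path.v by their origin x and the sequence p of the
   following vertices. *)
Definition walk (x y : T) (p : seq T) : Prop := path e x p /\ last x p = y.

Definition shortest_path (x y : T) (p : seq T) : Prop :=
  walk x y p /\ forall q, walk x y q -> size p <= size q.

Definition walk_edges (x : T) (p : seq T) : seq {set T} :=
  pairmap (fun a b => [set a; b]) x p.

(* Vacuously true if there is no walk from x to y, hence only meaningful in a
   connected graph. *)
Definition monitors (x y a b : T) : Prop :=
  forall p, shortest_path x y p -> [set a; b] \in walk_edges x p.

Definition connected_meg_set (M : {set T}) : Prop :=
  forall a b, e a b -> exists x y, [/\ x \in M, y \in M & monitors x y a b].

End Graph.

Arguments induced {T} e C.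

Definition meg_set (T : finType) (e : rel T) (M : {set T}) : Prop :=
  (connected e -> connected_meg_set e M) /\
  (~ connected e -> forall x,
     (isolated e x -> x \notin M) /\
     (~ isolated e x ->
        connected_meg_set (induced e (component e x))
          [set y | val y \in M])).

(* The default value #|T| bounds every #|M|, and MEG-sets always exist
   (meg_set_exists), so this is the minimum size of a MEG-set. *)
Definition meg (T : finType) (e : rel T) : nat :=
  \big[minn/#|T|]_(M : {set T} | `[< meg_set e M >]) #|M|.

Lemma connected_meg_set_ends (T : finType) (e : rel T) (M : {set T}) :
  irreflexive e -> (forall x y, e x y -> x \in M /\ y \in M) ->
  connected_meg_set e M.
Proof.
move=> eirr eM a b eab; exists a, b; have [aM bM] := eM _ _ eab.
split=> // p [[pp lp] /(_ [:: b])] /=.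
have sab : walk e a b [:: b] by split; rewrite //= eab.
move=> /(_ sab); case: p pp lp => [|c [|d p]] //= pp lp _.
  by move: eab; rewrite -lp eirr.
by rewrite -lp inE.
Qed.

Lemma meg_set_exists (T : finType) (e : rel T) :
  simple_graph e -> meg_set e [set x | [exists y, e x y]].
Proof.
move=> [esym eirr].
have eM x y : e x y -> (x \in [set x | [exists y, e x y]]) /\
                       (y \in [set x | [exists y, e x y]]).
  move=> exy; rewrite !inE; split; apply/existsP; first by exists y.
  by exists x; rewrite esym.
split=> [_|_ x]; first exact: connected_meg_set_ends.
split=> [xI|_].
  by rewrite inE; apply/existsPn.
apply: connected_meg_set_ends => [y|y z eyz]; first exact: eirr.
by rewrite !(in_set (fun y => val y \in _)); exact: eM.
Qed.

Lemma meg_min (T : finType) (e : rel T) :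
  simple_graph e ->
  (exists2 M, meg_set e M & #|M| = meg e) /\
  (forall M, meg_set e M -> meg e <= #|M|).
Proof.
move=> eS.
have le M : meg_set e M -> meg e <= #|M|.
  move=> /asboolP HM; rewrite /meg; have := mem_index_enum M.
  elim: (index_enum _) => // N s IH; rewrite inE big_cons => /predU1P[<-|/IH le_s].
    by rewrite HM geq_minl.
  by case: ifP => // _; rewrite (leq_trans (geq_minr _ _)).
split=> //.
have : (exists2 M, meg_set e M & #|M| = meg e) \/ meg e = #|T|.
  rewrite /meg; elim/big_rec: _ => [|M k /asboolP HM IH]; first by right.
  rewrite /minn; case: ifP => // _; by left; exists M.
case=> // megT; exists [set x | [exists y, e x y]]; first exact: meg_set_exists.
apply/eqP; rewrite eqn_leq (le _ (meg_set_exists eS)) andbT megT.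
exact: max_card.
Qed.

(* Main.v *)
(** In a forest the smallest MEG-set is the set of leaves, so [meg] counts the
    vertices of degree one, and deleting [uv] lowers only the degrees of [u] and
    [v]. Indeed, a leaf is interior to no shortest path, hence it belongs to
    every MEG-set. Conversely, an edge [ab] of a forest is a bridge; a maximal
    path leaving [ab] on either side ends in a leaf, and every walk joining two
    such leaves crosses [ab]. *)
Require Import Defs.
From mathcomp Require Import all_boot.
From mathcomp Require Import boolp.
From mathcomp Require Import zify.

Set Implicit Arguments.
Unset Strict Implicit.
Unset Printing Implicit Defensive.

(** * Leaves, bridges and monitored edges *)

Definition leaves (T : finType) (e : rel T) : {set T} := [set x | deg e x == 1].

Section Graph.
Variables (T : finType) (e : rel T).

Lemma leafP x :
  reflect (exists2 y, e x y & forall z, e x z -> z = y) (x \in leaves e).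
Proof.
rewrite inE; apply: (iffP cards1P) => [[y Ey]|[y exy yU]].
  have eE z : e x z = (z == y) by rewrite -in_set1 -Ey inE.
  by exists y => [|z]; rewrite eE // => /eqP.
exists y; apply/setP => z; rewrite !inE; apply/idP/eqP => [/yU //|->//].
Qed.

Lemma del_edgeC a b : del_edge e a b =2 del_edge e b a.
Proof. by move=> x y; rewrite /del_edge /= [[set b; a]]setUC. Qed.

Lemma del_edge_simple u v : simple_graph e -> simple_graph (del_edge e u v).
Proof.
move=> [esym eirr]; split=> [x y|x]; rewrite /del_edge /= ?eirr //.
by rewrite esym [[set x; y]]setUC.
Qed.

Lemma path_del_edge a b x p :
  path (del_edge e a b) x p = path e x p && ([set a; b] \notin walk_edges x p).
Proof.
elim: p x => //= y p IH x; rewrite IH inE negb_or [[set a; b] == _]eq_sym.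
by rewrite -!andbA; congr (_ && _); rewrite andbCA.
Qed.

(** Needed because [monitors] is vacuous when no shortest path exists. *)
Lemma shortest_path_exists x y :
  connect e x y -> exists p, shortest_path e x y p.
Proof.
move=> /connectP[p0 p0P y_p0].
pose P k := `[< exists2 p, walk e x y p & size p = k >].
have exP : exists k, P k by exists (size p0); apply/asboolP; exists p0.
case: (ex_minnP exP) => k /asboolP[p pP <-] min_k.
by exists p; split=> // q qP; apply: min_k; apply/asboolP; exists q.
Qed.

Lemma leaf_in_meg_set (M : {set T}) :
  symmetric e -> connected e -> connected_meg_set e M -> leaves e \subset M.
Proof.
move=> esym econ MP; apply/subsetP => x /leafP[y exy yU].
have [a [b [aM bM ab_xy]]] := MP _ _ exy.
have [p pP] := shortest_path_exists (econ a b).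
have xp : x \in a :: p.
  have := ab_xy _ pP; elim: (p) (a) => //= c q IH d.
  rewrite inE => /predU1P[E|/IH xq].
    have /set2P[->|->] : x \in [set d; c] by rewrite -E set21.
      exact: mem_head.
    by rewrite !inE eqxx orbT.
  by rewrite inE xq orbT.
case: pP => -[]; move: xp; rewrite inE => /predU1P[->//|].
case/splitPr=> p1 [|c p2].
  by rewrite last_cat /= => _ ->.
rewrite cat_path last_cat /= => /and4P[p1P ex exc p2P] p2b /(_ (p1 ++ p2)).
(* An interior leaf [x] has its only neighbour both before and after it on the path, so dropping [x]
   and [c] leaves a shorter walk. *)
rewrite esym in ex; have lc : last a p1 = c by rewrite (yU _ ex) (yU _ exc).
rewrite !size_cat /= leq_add2l ltnNge leqnSn /= => lt.
suff /lt : walk e a b (p1 ++ p2) by [].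
by split; rewrite ?cat_path ?last_cat lc ?p1P.
Qed.

(** A repetition-free path from [a] to [b] avoiding [ab] would close up with [ab] to a cycle of
    length at least 3. *)
Lemma bridge a b :
  irreflexive e -> acyclic e -> symmetric e -> e a b ->
  ~~ connect (del_edge e a b) a b.
Proof.
move=> eirr eac esym eab; apply/connectP => -[p0 p0P].
case: (shortenP p0P) => p pP pU _ lp.
have : ucycle e (a :: p).
  rewrite /ucycle pU andbT /= rcons_path -lp esym eab andbT.
  by move: pP; rewrite path_del_edge => /andP[].
move=> /eac; case: p {pU} pP lp => [|c [|d p]] //= pP lb _.
  by move: eab; rewrite lb eirr.
by move: pP; rewrite -lb /del_edge /= eqxx andbF.
Qed.

(* Paths are read backwards: the path from [b] to [w] is extended at [w]. *)
Lemma path_to_leaf w q b :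
  simple_graph e -> acyclic e ->
  path e w (rcons q b) -> uniq (w :: rcons q b) ->
  exists x r, [/\ x \in leaves e, path e x (rcons r b),
                  uniq (x :: rcons r b) & last x r = last w q].
Proof.
move=> [esym eirr] eac.
(* Induction on a bound for the room left to extend the path. *)
have [k] := ubnP (#|T| - size q); elim: k w q => // k IH w q ltk wP wU.
have [wL|/leafP wNL] := boolP (w \in leaves e); first by exists w, q.
have [c [s Es]] : exists c s, rcons q b = c :: s.
  by case: (q) => [|c s]; [exists b, [::] | exists c, (rcons s b)].
have ewc : e w c by move: wP; rewrite Es /= => /andP[].
have [d ewd dc] : exists2 d, e w d & d != c.
  apply: contrapT => H; apply: wNL; exists c => // z ewz.
  by apply/eqP; apply: contrapT => /negP zc; apply: H; exists z.
have dw : d != w by apply: contraTneq ewd => ->; rewrite eirr.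
(* If [d] lay on the path, the stretch from [w] to [d], which passes through [c], would close up to
   a cycle of length at least 3. *)
have dNs : d \notin s.
  apply/negP => ds; move: wP wU; rewrite Es; case/splitPr: ds => s1 s2.
  rewrite -cat_rcons -!cat_cons cat_path cat_uniq.
  move=> /andP[dP _] /and3P[dU _ _].
  have := eac (w :: rcons (c :: s1) d).
  rewrite /ucycle dU andbT [cycle _ _]rcons_path dP last_rcons esym ewd.
  by rewrite /= size_rcons => /(_ isT).
have dU : uniq (d :: w :: rcons q b).
  by rewrite cons_uniq wU Es !inE (negPf dw) (negPf dc) (negPf dNs).
have := IH d (w :: q); apply => //.
  (* Distinctness keeps [size q] below [#|T|], so the truncated difference really decreases. *)
  have := max_card (mem (d :: w :: rcons q b)); rewrite (card_uniqP dU) /=.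
  rewrite size_rcons => lt.
  rewrite -ltnS (leq_trans _ ltk) // ltnS ltn_sub2l //.
  exact: ltn_trans lt.
by rewrite rcons_cons /= esym ewd.
Qed.

(** Extend the one-edge path [ab] beyond [a] to a leaf; as [b] occurs only at its end, the part up
    to [a] does not use [ab]. *)
Lemma leaf_beyond_edge a b :
  simple_graph e -> acyclic e -> e a b ->
  exists2 x, x \in leaves e & connect (del_edge e a b) x a.
Proof.
move=> eS eac eab; have [esym eirr] := eS.
have ab : a != b by apply: contraTneq eab => ->; rewrite eirr.
have [||x [r [xL xP xU lr]]] := @path_to_leaf a [::] b eS eac.
- by rewrite /= eab.
- by rewrite /= inE ab.
exists x => //; apply/connectP; exists r; rewrite ?lr //.
rewrite path_del_edge; move: xP xU; rewrite rcons_path => /andP[-> _] /=.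
rewrite rcons_uniq mem_rcons inE negb_or => /andP[/andP[xb _] /andP[br _]].
elim: r x xb br {xL lr} => //= y r IH x xb; rewrite !inE !negb_or.
move=> /andP[yb br]; rewrite IH // 1?eq_sym // andbT.
apply/eqP => /setP/(_ b); rewrite !inE eqxx orbT.
by rewrite [b == x]eq_sym (negPf xb) (negPf yb).
Qed.

Lemma leaves_connected_meg_set (M : {set T}) :
  simple_graph e -> acyclic e -> leaves e \subset M -> connected_meg_set e M.
Proof.
move=> eS eac /subsetP LM a b eab; have [esym eirr] := eS.
have eba : e b a by rewrite esym.
have [x xL xa] := leaf_beyond_edge eS eac eab.
have [y yL yb] := leaf_beyond_edge eS eac eba.
exists x, y; split; rewrite ?LM // => p [[pP lp] _].
(* A walk from [x] to [y] missing [ab] would connect [a] to [b] through [x] and [y] after the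
   deletion, contradicting [bridge]. *)
apply: contraT => abp.
have dsym : connect_sym (del_edge e a b).
  by apply: sym_connect_sym; case: (del_edge_simple a b eS).
rewrite (eq_connect (del_edgeC b a)) in yb.
rewrite -(negPf (bridge eirr eac esym eab)) dsym.
rewrite -(same_connect dsym yb) dsym.
suff -> : connect (del_edge e a b) a y by [].
rewrite -(same_connect dsym xa); apply/connectP; exists p => //.
by rewrite path_del_edge pP.
Qed.

End Graph.

(** * Passing to a connected component *)

Section Component.
Variables (T : finType) (e : rel T) (x : T).
Hypotheses (eS : simple_graph e) (eac : acyclic e).
Let C := component e x.

Lemma induced_simple : simple_graph (induced e C).
Proof.
by have [esym eirr] := eS; split=> [y z|y]; rewrite /induced /= ?eirr.
Qed.

Lemma induced_acyclic : acyclic (induced e C).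
Proof.
move=> c /andP[cP cU]; rewrite -(size_map val); apply: eac.
by rewrite /ucycle (map_inj_uniq val_inj) cU andbT cycle_map.
Qed.

Lemma component_closed y z : y \in C -> e y z -> z \in C.
Proof. by rewrite !inE => xy /connect1; apply: connect_trans. Qed.

Lemma induced_connected : connected (induced e C).
Proof.
have sym : connect_sym (induced e C).
  by apply: sym_connect_sym; case: induced_simple.
(* A path starting in [C] never leaves it, so it lifts to the subtype vertex by vertex. *)
have path_lift p (y z : {x | x \in C}) :
    path e (val y) p -> val z = last (val y) p -> connect (induced e C) y z.
  elim: p y => [|w p IH] y /=; first by move=> _ /val_inj->.
  move=> /andP[yw wP] lp; have wC := component_closed (valP y) yw.
  apply: connect_trans (IH (Sub w wC) _ _) => //=.
  exact: connect1.
have xC : x \in C by rewrite inE.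
have xy y : connect (induced e C) (Sub x xC) y.
  have := valP y; rewrite /= [_ \in _]inE => /connectP[p pP lp].
  exact: (@path_lift p).
by move=> y z; apply: connect_trans (xy z); rewrite sym.
Qed.

(** A component contains all neighbours of its vertices, so degrees do not change. *)
Lemma induced_leaf y : (y \in leaves (induced e C)) = (val y \in leaves e).
Proof.
rewrite !inE /deg -(card_imset _ val_inj); congr (#|pred_of_set _| == 1).
apply/setP => z; apply/imsetP/idP => [[w + ->]|]; first by rewrite !inE.
rewrite inE => yz; have zC := component_closed (valP y) yz.
by exists (Sub z zC); rewrite ?inE.
Qed.

End Component.

(** * The value of [meg] on forests *)

Section Forest.
Variables (T : finType) (e : rel T).
Hypotheses (eS : simple_graph e) (eac : acyclic e).

Lemma leaves_meg_set : meg_set e (leaves e).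
Proof.
split=> [_|_ x]; first exact: leaves_connected_meg_set.
split=> [xI|_]; first by apply/leafP => -[y]; rewrite (negPf (xI y)).
apply: leaves_connected_meg_set.
- exact: induced_simple.
- exact: induced_acyclic.
by apply/subsetP => y; rewrite induced_leaf => yL; rewrite in_set.
Qed.

Lemma leaves_sub_meg_set M : meg_set e M -> leaves e \subset M.
Proof.
move=> [Mcon MNcon]; have [esym _] := eS.
have [econ|eNcon] := pselect (connected e).
  exact: leaf_in_meg_set (Mcon econ).
(* A leaf is not isolated, so the connected case applies to its own component. *)
apply/subsetP => x xL; have [_] := MNcon eNcon x.
have xNI : ~ isolated e x by case/leafP: (xL) => y xy _ /(_ y); rewrite xy.
move=> /(_ xNI) /leaf_in_meg_set.
have xC : x \in component e x by rewrite inE.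
have [isym _] : simple_graph (induced e (component e x)).
  exact: induced_simple.
move=> /(_ isym (induced_connected eS)) /subsetP/(_ (Sub x xC)).
by rewrite induced_leaf => /(_ xL); rewrite in_set.
Qed.

Lemma meg_forest : meg e = #|leaves e|.
Proof.
have [[M /leaves_sub_meg_set/subset_leq_card LM EM] meg_le] := meg_min eS.
by apply/eqP; rewrite eqn_leq meg_le -?EM //; exact: leaves_meg_set.
Qed.

End Forest.

(** * Leaves after deleting an edge *)

Section DeleteEdge.
Variables (T : finType) (e : rel T).

Lemma del_edge_acyclic u v : acyclic e -> acyclic (del_edge e u v).
Proof.
move=> eac c /andP[cP cU]; apply: eac; rewrite /ucycle cU andbT.
by apply: sub_cycle cP => x y /andP[].
Qed.

Lemma deg_del_edge_end u v :
  irreflexive e -> e u v -> deg e u = (deg (del_edge e u v) u).+1.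
Proof.
move=> eirr euv; rewrite /deg (cardsD1 v) inE euv add1n; congr _.+1.
apply: eq_card => y; rewrite !inE andbC /=; congr (_ && ~~ _).
apply/eqP/eqP => [->//|/setP/(_ v)]; rewrite !inE eqxx orbT.
by case/orP=> /eqP // vu; move: euv; rewrite vu eirr.
Qed.

Lemma deg_del_edge_other u v x :
  x != u -> x != v -> deg (del_edge e u v) x = deg e x.
Proof.
move=> xu xv; apply: eq_card => y; rewrite !inE /=; apply: andb_idr => _.
by apply/eqP => /setP/(_ x); rewrite !inE eqxx (negPf xu) (negPf xv).
Qed.

(** Each end loses one from its degree: it was a leaf if the degree was 1 and becomes one if it was
    2. Other vertices keep their status. The additive form avoids truncated subtraction and covers
    all five cases at once. *)
Lemma card_leaves_del_edge u v :
  simple_graph e -> e u v ->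
  #|leaves (del_edge e u v)| + (deg e u == 1) + (deg e v == 1) =
  #|leaves e| + (deg e u == 2) + (deg e v == 2).
Proof.
move=> [esym eirr] euv; have evu : e v u by rewrite esym.
have uv : v != u by apply: contraTneq euv => ->; rewrite eirr.
have dv : deg e v = (deg (del_edge e u v) v).+1.
  rewrite (deg_del_edge_end eirr evu); congr _.+1.
  by apply: eq_card => y; rewrite !inE del_edgeC.
have rest : #|leaves (del_edge e u v) :\ u :\ v| = #|leaves e :\ u :\ v|.
  apply: eq_card => x; rewrite !inE.
  have [//|xv] := eqVneq x v; have [//|xu] := eqVneq x u.
  by rewrite deg_del_edge_other.
have card2 (A : {set T}) : #|A| = (u \in A) + ((v \in A) + #|A :\ u :\ v|).
  by rewrite (cardsD1 u) (cardsD1 v) !inE uv.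
rewrite card2 rest (card2 (leaves e)) !inE.
rewrite dv (deg_del_edge_end eirr euv) !eqSS.
lia.
Qed.

End DeleteEdge.

Theorem theorem3p1 (T : finType) (e : rel T) (n : nat) (u v : T)
    (e_tree : tree e) (order_n : #|T| = n) (e_uv : e u v) :
  let e' := del_edge e u v in
  (deg e u = 1 -> deg e v = 1 -> meg e' = 0) /\
  ((deg e u = 1 /\ deg e v = 2) \/ (3 <= deg e u /\ 3 <= deg e v) ->
     meg e' = meg e) /\
  (deg e u = 2 -> deg e v = 2 -> meg e' = meg e + 2) /\
  (deg e u = 2 -> 3 <= deg e v -> meg e' = meg e + 1) /\
  (deg e u = 1 -> 3 <= deg e v -> meg e' + 1 = meg e).
Proof.
case: e_tree => eS _ econ eac e'.
have mE' : meg e' = #|leaves e'|.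
  by apply: meg_forest; [exact: del_edge_simple | exact: del_edge_acyclic].
rewrite mE' (meg_forest eS eac); have := card_leaves_del_edge eS e_uv.
split=> [du dv|]; last by rewrite /e'; lia.
(* In case (i) the count gives two leaves fewer in [e'], so it remains to bound the leaves of [e] by
   2. *)
suff : #|leaves e| <= 2 by rewrite /e'; lia.
have [esy _] := eS.
have nbr a b : deg e a = 1 -> e a b -> forall z, e a z -> z = b.
  move=> da eab z eaz; have /leafP[w _ wU] : a \in leaves e by rewrite inE da.
  by rewrite (wU _ eaz) (wU _ eab).
(* Both ends have no other neighbour, so by connectedness [u] and [v] are the only vertices. *)
have uvC : closed e [set u; v].
  apply: intro_closed => [|x y + /set2P[]xE]; first exact: sym_connect_sym.
    by rewrite xE => /(nbr _ _ du e_uv)->; rewrite set22.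
  by rewrite xE => /(nbr v u dv)->; rewrite ?set21 // esy.
apply: leq_trans (_ : #|[set u; v]| <= 2); last by rewrite cards2; case: eqP.
apply/subset_leq_card/subsetP => x _.
by rewrite -(closed_connect uvC (econ u x)) set21.
Qed.
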